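(* Let $G=(\mathcal S,E)$ be a finite graph and $\mu=(\mu(s):s\in\mathcal S)$ a probability distribution on $\mathcal S$. For a stochastic process $X=(X(t):t\in\mathbb N)$ on $\mathcal S$ consider the property $$(\ast)\qquad \lim_{t\to\infty}\frac1t\sum_{m=0}^{t-1}\mathbf 1_{\{X(m)=s\}}=\mu(s)\quad\text{for all }s\in\mathcal S,\quad\text{almost surely.}$$ (a) If the induced subgraph $G[\mathrm{supp}(\mu)]$ is connected, then every homogeneous Markov chain $X=(X(t):t\in\mathbb N)$ with state space $\mathrm{supp}(\mu)$ and transition matrix $P^{(\mu,G[\mathrm{supp}(\mu)])}$ (defined in the context) satisfies $(\ast)$. Furthermore, $X$ is consistent with $G$. (b) If $G[\mathrm{supp}(\mu)]$ is not connected, then no homogeneous Markov chain on $\mathcal S$ consistent with $G$ satisfies $(\ast)$.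
   Context: Graphs are finite, simple and undirected. $G[\mathcal S']$ is the subgraph of $G$ induced by $\mathcal S'\subset\mathcal S$; $\mathrm{supp}(\mu)=\{s:\mu(s)>0\}$. Two vertices $s,t\in\mathcal S$ are adjacent in $G$ if $\{s,t\}\in E$ or $s=t$. A stochastic process $X=(X(t):t\in\mathbb N)$ on $\mathcal S$ is consistent with $G$ if, for each $t\in\mathbb N$, $X(t)$ and $X(t+1)$ are adjacent in $G$ with probability one. The matrix $P^{(\mu,G[\mathrm{supp}(\mu)])}$. Let $M=|\mathrm{supp}(\mu)|$, let $E'$ be the edge set of $G[\mathrm{supp}(\mu)]$, and label $\mathrm{supp}(\mu)=\{s^1,\dots,s^M\}$ so that $\mu(s^1)\ge\cdots\ge\mu(s^M)$. If $M=1$ the matrix is $(1)$. If $M\ge2$, it is $(p_{l,m})_{l,m=1,\dots,M}$ with $$p_{l,m}=\begin{cases}p,& l<m,\ \{s^l,s^m\}\in E',\\ \frac{\mu(s^m)}{\mu(s^l)}\,p,& l>m,\ \{s^l,s^m\}\in E',\\ 1-p\,D_l,& l=m,\\ 0,&\text{otherwise,}\end{cases}$$ where $$D_l=\sum_{m'>l}\mathbf 1_{\{\{s^l,s^{m'}\}\in E'\}}+\sum_{m'<l}\frac{\mu(s^{m'})}{\mu(s^l)}\mathbf 1_{\{\{s^l,s^{m'}\}\in E'\}},\qquad p=\min_{l=1,\dots,M}\frac{1}{2D_l}.$$ *)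

(* Defs.v *)
From HB Require Import structures.
From mathcomp Require Import all_boot all_order all_algebra.
From mathcomp Require Import all_classical all_reals all_analysis.
Set Implicit Arguments.
Unset Strict Implicit.
Unset Printing Implicit Defensive.
Import Order.TTheory GRing.Theory Num.Theory.
Import numFieldNormedType.Exports.
Local Open Scope classical_set_scope.
Local Open Scope ring_scope.

(* A finite simple graph on S is a symmetric irreflexive relation E : rel S. *)

Definition adjacent_in (S : finType) (E : rel S) (s t : S) : bool :=
  E s t || (s == t).

Definition induced_graph (S : finType) (E : rel S) (A : {set S}) :
  rel {s : S | s \in A} := fun s t => E (val s) (val t).
Arguments induced_graph {S} E A s t.

(* Vacuously true of the graph with no vertex; it is only applied to the
   support of a probability distribution, which is never empty. *)
Definition connected_graph (S : finType) (E : rel S) : Prop :=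
  forall s t : S, connect E s t.

Definition distribution_on (R : realType) (S : finType) (mu : S -> R) : Prop :=
  (forall s, 0 <= mu s) /\ \sum_(s : S) mu s = 1.

Definition supp (R : realType) (S : finType) (mu : S -> R) : {set S} :=
  [set s | 0 < mu s]%SET.

Section TransitionMatrix.
Variables (R : realType) (S : finType) (E : rel S) (mu : S -> R) (n : nat).
(* lab enumerates supp mu = {s^1, ..., s^M}, with M = n.+1 (the support is
   nonempty) and indices shifted to 0, ..., n. *)
Variable lab : 'I_n.+1 -> {s : S | s \in supp mu}.

(* Ties are allowed: a distribution may have several such labellings. *)
Definition decreasing_labelling : Prop :=
  bijective lab /\
  forall l m : 'I_n.+1, (l <= m)%N -> mu (val (lab m)) <= mu (val (lab l)).

Definition lab_edge (l m : 'I_n.+1) : bool :=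
  induced_graph E (supp mu) (lab l) (lab m).

Definition lab_ratio (l m : 'I_n.+1) : R :=
  mu (val (lab m)) / mu (val (lab l)).

Definition D_coef (l : 'I_n.+1) : R :=
  \sum_(m < n.+1 | (l < m)%N) (lab_edge l m)%:R
  + \sum_(m < n.+1 | (m < l)%N) lab_ratio l m * (lab_edge l m)%:R.

(* The default value of the iterated minimum is one of the terms, so that this
   is exactly the minimum over all l. *)
Definition p_coef : R :=
  \big[Num.min/(2 * D_coef ord0)^-1]_(l < n.+1) (2 * D_coef l)^-1.

Definition P_matrix : 'M[R]_n.+1 :=
  \matrix_(l, m)
    if n.+1 == 1%N then 1
    else if (l < m)%N && lab_edge l m then p_coef
    else if (m < l)%N && lab_edge l m then lab_ratio l m * p_coef
    else if l == m then 1 - p_coef * D_coef l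
    else 0.

End TransitionMatrix.

Section Processes.
Variables (R : realType) (d : measure_display) (Omega : measurableType d).
Variables (P : probability Omega R) (S : finType) (X : nat -> Omega -> S).

(* Each X t is a random variable for the discrete sigma-algebra on S. *)
Definition stochastic_process : Prop :=
  forall (t : nat) (s : S), measurable [set w | X t w = s].

Definition cond_prob (A B : set Omega) : R := fine (P (A `&` B)) / fine (P B).

Definition stochastic_matrix (Q : S -> S -> R) : Prop :=
  (forall s s', 0 <= Q s s') /\ (forall s, \sum_(s' : S) Q s s' = 1).

(* The event X 0 = x 0, ..., X t = x t. *)
Definition history (t : nat) (x : nat -> S) : set Omega :=
  [set w | forall i, (i <= t)%N -> X i w = x i].

(* No condition is put on the law of X 0. *)
Definition markov_chain_with (Q : S -> S -> R) : Prop :=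
  stochastic_process /\
  forall (t : nat) (x : nat -> S) (s : S), (0 < P (history t x))%E ->
    cond_prob [set w | X t.+1 w = s] (history t x) = Q (x t) s.

Definition homogeneous_markov_chain : Prop :=
  exists Q : S -> S -> R, stochastic_matrix Q /\ markov_chain_with Q.

Definition consistent (E : rel S) : Prop :=
  forall t : nat, P [set w | adjacent_in E (X t w) (X t.+1 w)] = 1%E.

(* At t = 0 the average is 0^-1 * 0 = 0, which does not affect the limit. *)
Definition frequencies_converge (mu : S -> R) : Prop :=
  {ae P, forall w, forall s : S,
    (fun t : nat => t%:R^-1 * \sum_(0 <= m < t) (X m w == s)%:R : R)
      @ \oo --> mu s}.

End Processes.

(* Main.v *)
(* Let Q be the transition kernel of a finite chain X.  For every g,
   sum_(m < t) (g(X_(m+1)) - (Qg)(X_m)) is a martingale with bounded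
   increments, so its second moment is O(t); Chebyshev and Borel-Cantelli along
   the squares t = k^2 show that its quotient by t tends to 0 almost surely, and
   hence that the average of g - Qg along X tends to 0.

   (a) P^(mu, G[supp mu]) is reversible with respect to mu, and irreducible when
   G[supp mu] is connected, so the Poisson equation g - Qg = 1_s - mu(s) has a
   solution g.

   (b) If the frequencies of a chain converge to mu, then the averages of
   g - Qg for g = 1_s give mu Q = mu, so that supp mu is closed under the
   transitions of Q.  Every state of supp mu is visited with positive
   probability, so by consistency these transitions follow edges of G[supp mu];
   from a visited vertex the chain then never leaves its connected component,
   and the other components of G[supp mu], having positive frequency, cannot
   exist. *)

Require Import Defs.
From HB Require Import structures.
From mathcomp Require Import all_boot all_order all_algebra.
From mathcomp Require Import all_classical all_reals all_analysis.
From mathcomp Require Import ring lra zify.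
Import Order.TTheory GRing.Theory Num.Theory.
Import numFieldNormedType.Exports.
Local Open Scope classical_set_scope.
Local Open Scope ring_scope.

(** * Poisson equation of a reversible kernel *)

Section FiniteKernels.
Context {R : realType} {T : finType}.
Variables (Q : T -> T -> R).

Definition kernel_op (g : T -> R) (s : T) : R := \sum_s' Q s s' * g s'.

Variable pi : T -> R.
Hypothesis pi_gt0 : forall s, 0 < pi s.
Hypothesis pi_sum1 : \sum_s pi s = 1.
Hypothesis Qst : stochastic_matrix Q.
Hypothesis Qrev : forall s s', pi s * Q s s' = pi s' * Q s' s.

Lemma reversible_invariant s' : \sum_s pi s * Q s s' = pi s'.
Proof.
under eq_bigr do rewrite Qrev.
by rewrite -mulr_sumr (proj2 Qst) mulr1.
Qed.

Lemma reversible_kernel_op g : \sum_s pi s * kernel_op g s = \sum_s pi s * g s.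
Proof.
under eq_bigr do rewrite mulr_sumr.
rewrite exchange_big; apply: eq_bigr => s' _ /=.
by under eq_bigr do rewrite mulrA; rewrite -mulr_suml reversible_invariant.
Qed.

(** Expanding the square, row sums equal to one and invariance of [pi] turn both squared terms into
    the [pi]-mean of [g ^+ 2]; the cross term is the pairing of [g] with [kernel_op g]. *)
Lemma dirichlet_form g :
  \sum_s \sum_s' pi s * Q s s' * (g s - g s') ^+ 2
  = 2 * \sum_s pi s * g s * (g s - kernel_op g s).
Proof.
have e1 : \sum_s \sum_s' pi s * Q s s' * g s ^+ 2 = \sum_s pi s * g s ^+ 2.
  apply: eq_bigr => s _; rewrite -mulr_suml -mulr_sumr (proj2 Qst).
  by rewrite mulr1.
have e2 : \sum_s \sum_s' pi s * Q s s' * g s' ^+ 2 = \sum_s pi s * g s ^+ 2.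
  rewrite exchange_big; apply: eq_bigr => s' _ /=.
  by rewrite -mulr_suml reversible_invariant.
have e3 : \sum_s \sum_s' pi s * Q s s' * (g s * g s')
          = \sum_s pi s * g s * kernel_op g s.
  apply: eq_bigr => s _; rewrite mulr_sumr; apply: eq_bigr => s' _; ring.
transitivity (\sum_s \sum_s' pi s * Q s s' * g s ^+ 2
  + \sum_s \sum_s' pi s * Q s s' * g s' ^+ 2
  - 2 * \sum_s \sum_s' pi s * Q s s' * (g s * g s')).
  rewrite mulr_sumr -big_split -sumrB; apply: eq_bigr => s _ /=.
  rewrite mulr_sumr -big_split -sumrB; apply: eq_bigr => s' _ /=; ring.
rewrite e1 e2 e3.
have -> : \sum_s pi s * g s * (g s - kernel_op g s)
  = \sum_s pi s * g s ^+ 2 - \sum_s pi s * g s * kernel_op g s.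
  by rewrite -sumrB; apply: eq_bigr => s _; ring.
ring.
Qed.

Variable e : rel T.
Hypothesis e_conn : forall s s', connect e s s'.
Hypothesis e_pos : forall s s', e s s' -> 0 < Q s s'.

(** A harmonic function has zero Dirichlet energy, so each nonnegative term vanishes. On an edge the
    weight is positive, hence [g] agrees at its ends, and connectedness spreads this. *)
Lemma harmonic_cst g :
  (forall s, kernel_op g s = g s) -> forall s s', g s = g s'.
Proof.
move=> hg s s'.
have D0 : \sum_s \sum_s' pi s * Q s s' * (g s - g s') ^+ 2 = 0.
  by rewrite dirichlet_form big1 ?mulr0// => x _; rewrite hg subrr mulr0.
have nn x y : 0 <= pi x * Q x y * (g x - g y) ^+ 2.
  by rewrite mulr_ge0 ?sqr_ge0// mulr_ge0 ?(proj1 Qst)// ltW.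
have ge x y : e x y -> g x = g y.
  move=> exy.
  have nnx z : true -> 0 <= \sum_y pi z * Q z y * (g z - g y) ^+ 2.
    by move=> _; apply: sumr_ge0 => ? _; exact: nn.
  have Dx := psumr_eq0P nnx D0 (i := x) isT.
  have nny z : true -> 0 <= pi x * Q x z * (g x - g z) ^+ 2 by move=> _.
  have /eqP := psumr_eq0P nny Dx (i := y) isT.
  rewrite mulf_eq0 mulf_eq0 gt_eqF//= gt_eqF ?e_pos//= sqrf_eq0 subr_eq0.
  by move/eqP.
have /connectP[p] := e_conn s s'.
elim: p s => [|y p IH] s /= => [_ -> //|/andP[/ge -> ep lp]].
exact: IH.
Qed.

(* Adding the rank-one operator g |-> pi(g) makes 1 - Q invertible without
   changing the solutions with pi(g) = 0. *)
Lemma poisson_equation h : \sum_s pi s * h s = 0 ->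
  exists g : T -> R, forall s, h s = g s - kernel_op g s.
Proof.
move=> h0.
pose A s s' : R := (s == s')%:R - Q s s' + pi s'.
have AE g s : \sum_s' A s s' * g s' = g s - kernel_op g s + \sum_s pi s * g s.
  rewrite /kernel_op.
  have -> : g s = \sum_s' (s == s')%:R * g s'.
    rewrite (bigD1 s)//= eqxx mul1r big1 ?addr0// => s' /negPf ns.
    by rewrite eq_sym ns mul0r.
  rewrite -sumrB -big_split; apply: eq_bigr => s' _; rewrite /A /=; ring.
have Api g : \sum_s pi s * (\sum_s' A s s' * g s') = \sum_s pi s * g s.
  under eq_bigr do rewrite AE mulrDr mulrBr.
  rewrite big_split/= sumrB reversible_kernel_op subrr add0r -mulr_suml.
  by rewrite pi_sum1 mul1r.
(* [M] is the transpose of [A], since functions are encoded as row vectors acting from the left. *)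
pose M := \matrix_(i < #|T|, j < #|T|) A (enum_val j) (enum_val i).
have ME (v : 'rV[R]_#|T|) (s : T) :
    (v *m M) 0 (enum_rank s) = \sum_s' A s s' * v 0 (enum_rank s').
  rewrite mxE (reindex_onto (@enum_rank T) enum_val) /=; last first.
    by move=> i _; rewrite enum_valK.
  apply: eq_big => [s'|s' _]; first by rewrite enum_rankK eqxx.
  by rewrite !mxE !enum_rankK mulrC.
(* Pairing a kernel element with [pi] shows that it has mean zero; it is then harmonic, hence
   constant, hence zero. *)
have Mu : M \in unitmx.
  rewrite -row_free_unit; apply: inj_row_free => v vM.
  pose g s := v 0 (enum_rank s).
  have Ag s : \sum_s' A s s' * g s' = 0 by rewrite -ME vM mxE.
  have pg : \sum_s pi s * g s = 0.
    by rewrite -Api big1// => s _; rewrite Ag mulr0.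
  have gc : forall s s', g s = g s'.
    apply: harmonic_cst => s; apply/eqP; rewrite eq_sym -subr_eq0.
    by have := AE g s; rewrite Ag pg addr0 => <-.
  apply/rowP => j; rewrite mxE -[j]enum_valK -/(g _).
  rewrite -pg -[LHS]mul1r -pi_sum1 mulr_suml.
  by apply: eq_bigr => s _; rewrite (gc s (enum_val j)).
pose v : 'rV[R]_#|T| := (\row_j h (enum_val j)) *m invmx M.
pose g s := v 0 (enum_rank s).
have Ag s : \sum_s' A s s' * g s' = h s.
  by rewrite -ME mulmxKV// mxE enum_rankK.
(* The same pairing gives [g] the mean of [h], which is zero, so the rank-one term drops out. *)
have pg : \sum_s pi s * g s = 0.
  by rewrite -Api; under eq_bigr do rewrite Ag.
by exists g => s; rewrite -Ag AE pg addr0.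
Qed.

End FiniteKernels.

(** * The transition matrix *)

Lemma ord1_eq n (l m : 'I_n.+1) : n = 0%N -> l = m.
Proof. by move=> n0; apply: val_inj; case: l m => [l hl] [m hm] /=; lia. Qed.

Section PMatrix.
Context {R : realType} {S : finType}.
Variables (E : rel S) (mu : S -> R) (n : nat).
Variable lab : 'I_n.+1 -> {s : S | s \in supp mu}.
Hypothesis E_sym : symmetric E.
Hypothesis E_irr : irreflexive E.
Hypothesis lab_bij : bijective lab.
Hypothesis conn : connected_graph (induced_graph E (supp mu)).

Let ratio_gt0 l m : 0 < lab_ratio lab l m.
Proof.
have pos k : 0 < mu (val (lab k)) by have := valP (lab k); rewrite inE.
exact: divr_gt0.
Qed.

Let edge_sym l m : lab_edge E lab l m = lab_edge E lab m l.
Proof. exact: E_sym. Qed.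

(** Each vertex of a connected graph with at least two vertices has a neighbour, which contributes 1
    or a positive ratio. This keeps the inverses in [p_coef] away from the default value
    [0^-1 = 0]. *)
Lemma D_coef_gt0 l : n != 0%N -> 0 < D_coef E lab l.
Proof.
move=> n0.
have [m lm] : exists m, lab_edge E lab l m.
  have [m ml] : exists m : 'I_n.+1, m != l.
    case: (eqVneq l ord0) => [->|l0]; last by exists ord0; rewrite eq_sym.
    by exists ord_max; apply/eqP => /(congr1 val) /= /eqP; rewrite (negPf n0).
  (* The first vertex on a path towards any other vertex is a neighbour. *)
  have /connectP[[|y p] /=] := conn (lab l) (lab m).
    move=> _ /(bij_inj lab_bij) eml.
    by rewrite eml eqxx in ml.
  move=> /andP[ly _] _; have [k _ kK] := lab_bij.
  by exists (k y); rewrite /lab_edge kK.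
have mnl : m != l.
  by apply: contraTneq lm => ->; rewrite /lab_edge /induced_graph E_irr.
have t0 k : 0 <= (lab_edge E lab l k)%:R :> R by [].
have t1 k : 0 <= lab_ratio lab l k * (lab_edge E lab l k)%:R.
  by rewrite mulr_ge0// ltW.
rewrite /D_coef; case: (ltngtP m l) => [ml|ml|/val_inj/eqP]; last 1 first.
  by rewrite (negPf mnl).
- apply: ltr_wpDl; first exact: sumr_ge0.
  by rewrite (bigD1 m)//= lm mulr1 ltr_pwDl// sumr_ge0.
- apply: ltr_pwDl; last by apply: sumr_ge0.
  by rewrite (bigD1 m)//= lm ltr_pwDl ?sumr_ge0.
Qed.

Lemma p_coef_gt0 : n != 0%N -> 0 < p_coef E lab.
Proof.
move=> n0; apply/bigmin_gtP.
by split=> [|l _]; rewrite invr_gt0 mulr_gt0 ?D_coef_gt0.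
Qed.

(** As a minimum, [p_coef] gives a product of at most 1/2, so the diagonal entries are positive. *)
Lemma p_coef_D_coef_lt1 l : n != 0%N -> p_coef E lab * D_coef E lab l < 1.
Proof.
move=> n0; have D0 := D_coef_gt0 l n0.
have : p_coef E lab <= (2 * D_coef E lab l)^-1 by exact: bigmin_le.
rewrite -(ler_pM2r D0) invfM -mulrA mulVf ?gt_eqF// mulr1.
move=> /le_lt_trans; apply.
by rewrite invf_lt1 ?ltr1n.
Qed.

Lemma P_matrix_ge0 l m : 0 <= P_matrix E lab l m.
Proof.
rewrite mxE; case: eqP => // /eqP; rewrite eqSS => n0.
have p0 := ltW (p_coef_gt0 n0).
case: ifP => // _; case: ifP => _; first by rewrite mulr_ge0// ltW.
by case: ifP => // _; rewrite subr_ge0 ltW// p_coef_D_coef_lt1.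
Qed.

Lemma P_matrix_edge_gt0 l m : lab_edge E lab l m -> 0 < P_matrix E lab l m.
Proof.
move=> lm.
have lnm : l != m.
  by apply: contraTneq lm => ->; rewrite /lab_edge /induced_graph E_irr.
have n0 : n != 0%N.
  by apply: contraNneq lnm => /ord1_eq n0; apply/eqP/n0.
rewrite mxE eqSS (negPf n0) lm !andbT.
have p0 := p_coef_gt0 n0.
case: (ltngtP l m) => // [_|/val_inj/eqP]; first by rewrite mulr_gt0.
by rewrite (negPf lnm).
Qed.

Lemma P_matrix_row_sum l : \sum_m P_matrix E lab l m = 1.
Proof.
have [n0|n0] := eqVneq n 0%N.
  rewrite (bigD1 l)//= big1 => [|m ml]; first last.
    by case/eqP: ml; exact: ord1_eq.
  by rewrite mxE eqSS (introT eqP n0) addr0.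
(* The entries above and below the diagonal add up to [p_coef] times [D_coef], which the diagonal
   entry compensates. *)
transitivity (\sum_(m < n.+1) (
  (if (l < m)%N then p_coef E lab * (lab_edge E lab l m)%:R else 0)
  + (if (m < l)%N
     then p_coef E lab * (lab_ratio lab l m * (lab_edge E lab l m)%:R) else 0)
  + (if m == l then 1 - p_coef E lab * D_coef E lab l else 0))).
  apply: eq_bigr => m _; rewrite mxE eqSS (negPf n0).
  case: (ltngtP l m) => [lm|ml|/val_inj ->] /=.
  - have /negPf -> : l != m by apply: contraTneq lm => ->; rewrite ltnn.
    have /negPf -> : m != l by apply: contraTneq lm => ->; rewrite ltnn.
    by case: lab_edge; rewrite ?mulr1 ?mulr0 !addr0.
  - have /negPf -> : l != m by apply: contraTneq ml => ->; rewrite ltnn.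
    have /negPf -> : m != l by apply: contraTneq ml => ->; rewrite ltnn.
    by case: lab_edge; rewrite ?mulr1 ?mulr0 add0r addr0// mulrC.
  - by rewrite eqxx !add0r.
rewrite !big_split/= -!big_mkcond/= big_pred1_eq -!mulr_sumr -mulrDr.
by rewrite -/(D_coef E lab l) addrC subrK.
Qed.

(** Across an edge, both sides are [p_coef] times the mass of the vertex with the smaller index; the
    ratio below the diagonal is chosen for this. *)
Lemma P_matrix_reversible l m :
  mu (val (lab l)) * P_matrix E lab l m = mu (val (lab m)) * P_matrix E lab m l.
Proof.
have mu0 k : mu (val (lab k)) != 0.
  by have := valP (lab k); rewrite inE => /gt_eqF ->.
have [n0|n0] := eqVneq n 0%N.
  by rewrite (ord1_eq _ l m n0).
rewrite !mxE eqSS (negPf n0) (edge_sym m l) /lab_ratio (eq_sym m l).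
have ratioK (p a b : R) : b != 0 -> b * (a / b * p) = a * p.
  by move=> b0; field.
case: (ltngtP l m) => [lm|ml|/val_inj ->] //=; case: lab_edge => /=.
- by rewrite ratioK//; exact: mu0.
- by case: (l =P m) => [->|]; rewrite ?mulr0.
- by rewrite ratioK//; exact: mu0.
- by case: (l =P m) => [->|]; rewrite ?mulr0.
Qed.

Lemma P_matrix_adjacent l m : P_matrix E lab l m != 0 ->
  adjacent_in E (val (lab l)) (val (lab m)).
Proof.
rewrite mxE /adjacent_in -/(lab_edge E lab l m); rewrite eqSS.
have [n0 _|n0] := eqVneq n 0%N.
  by rewrite (ord1_eq _ l m n0) eqxx orbT.
case elm: (lab_edge E lab l m); first by rewrite (elm : E _ _ = true).
rewrite !andbF.
by case: (l =P m) => [->|]; rewrite ?eqxx ?orbT.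
Qed.

End PMatrix.

(** * Finite-dimensional laws of a chain *)

Section ChainLaw.
Context {R : realType} {d : measure_display} {Omega : measurableType d}.
Variables (P : probability Omega R).

Lemma fine_probability_sum {U : finType} (Y : Omega -> U) (B : pred U) :
  (forall u, measurable [set w | Y w = u]) ->
  measurable [set w | B (Y w)] /\
  fine (P [set w | B (Y w)]) = \sum_(u | B u) fine (P [set w | Y w = u]).
Proof.
move=> mY.
have E : [set w | B (Y w)] = \bigcup_(u in [set` B]) [set w | Y w = u].
  apply/seteqP; split => [w /= Bw|w [u /= Bu Yu]]; last by rewrite Yu.
  by exists (Y w).
have Bfin : finite_set [set` B] by exact: finite_finpred.
split; first by rewrite E; apply: fin_bigcup_measurable.
have tY : trivIset [set` B] (fun u => [set w | Y w = u]).
  by move=> u v _ _ [w [/= <- <-]].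
rewrite E measure_fin_bigcup// sum_fine; last first.
  by move=> u _; exact: fin_num_measure.
congr fine; rewrite [RHS]bigfs ?index_enum_uniq// => u _.
by rewrite mem_index_enum.
Qed.

Lemma fine_probability_ge0 (A : set Omega) : 0 <= fine (P A).
Proof. exact/fine_ge0/measure_ge0. Qed.

Lemma fine_probability_le (A B : set Omega) : measurable A -> measurable B ->
  A `<=` B -> fine (P A) <= fine (P B).
Proof.
move=> mA mB AB; apply: fine_le; rewrite ?fin_num_measure//.
by apply: le_measure => //; rewrite inE.
Qed.

Context {T : finType}.
Variables (X : nat -> Omega -> T) (Q : T -> T -> R).
Hypothesis chainX : markov_chain_with P X Q.

(* The trajectory X_0, ..., X_t, most recent state first. *)
Fixpoint past (t : nat) : Omega -> t.+1.-tuple T :=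
  if t is t'.+1 then fun w => cons_tuple (X t'.+1 w) (past t' w)
  else fun w => [tuple X 0 w].

(** Links the finite type of trajectories, over which sums are taken, to the events in which the
    Markov property is stated. *)
Lemma past_history {t} (x : t.+1.-tuple T) : exists xf : nat -> T,
  xf t = thead x /\ [set w | past t w = x] = history X t xf.
Proof.
elim: t x => [|t IH] x.
  exists (fun=> thead x); split=> //.
  apply/seteqP; split => w /=.
    by move=> <- i; rewrite leqn0 => /eqP ->; rewrite theadE.
  move=> /(_ 0 isT) /= ->; case/tupleP: x => s x.
  by rewrite theadE; apply: val_inj; rewrite /= tuple0.
case/tupleP: x => s x; have [xf [xft xfE]] := IH x.
exists (fun i => if i == t.+1 then s else xf i).
split; first by rewrite eqxx theadE.
apply/seteqP; split => w /=.
  move=> [<- /val_inj xE] i; case: eqP => [->//|ne it].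
  have : [set w | past t w = x] w by [].
  by rewrite xfE; apply; lia.
move=> hw; apply: val_inj => /=; have := hw t.+1 (leqnn _).
rewrite eqxx => ->; congr (_ :: val _).
suff : history X t xf w by rewrite -xfE.
move=> i it; have := hw i (leqW it).
by case: eqP => // it'; lia.
Qed.

Lemma measurable_past {t} (x : t.+1.-tuple T) :
  measurable [set w | past t w = x].
Proof.
elim: t x => [|t IH] x.
  case/tupleP: x => s x.
  suff -> : [set w | past 0 w = cons_tuple s x] = [set w | X 0 w = s].
    exact: (proj1 chainX).
  apply/seteqP; split => w /=; first by move=> /(congr1 val) [].
  by move=> ->; apply: val_inj; rewrite /= tuple0.
case/tupleP: x => s x.
suff -> : [set w | past t.+1 w = cons_tuple s x]
    = [set w | X t.+1 w = s] `&` [set w | past t w = x].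
  by apply: measurableI => //; exact: (proj1 chainX).
apply/seteqP; split => w /=; first by move=> [-> /val_inj].
by move=> [-> ->].
Qed.

Definition law {t} (x : t.+1.-tuple T) : R := fine (P [set w | past t w = x]).

Lemma law_ge0 {t} (x : t.+1.-tuple T) : 0 <= law x.
Proof. exact: fine_probability_ge0. Qed.

Lemma law_cons {t} s (x : t.+1.-tuple T) :
  law (cons_tuple s x) = law x * Q (thead x) s.
Proof.
have E : [set w | past t.+1 w = cons_tuple s x]
    = [set w | X t.+1 w = s] `&` [set w | past t w = x].
  apply/seteqP; split => w /=; first by move=> [-> /val_inj].
  by move=> [-> ->].
rewrite /law E.
have mX : measurable [set w | X t.+1 w = s] by exact: (proj1 chainX).
have mp := measurable_past x.
have [xf [xft xfE]] := past_history x.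
(* The Markov property is silent on a null history; there the longer trajectory is null by
   monotonicity. *)
have [p0|p0] := eqVneq (fine (P [set w | past t w = x])) 0.
  rewrite p0 mul0r; apply/eqP; rewrite eq_le fine_probability_ge0 andbT -p0.
  by apply: fine_probability_le => //; exact: measurableI.
have := (proj2 chainX) t xf s; rewrite xft -xfE => <-.
  by rewrite /cond_prob mulrC divfK.
rewrite lt0e measure_ge0 andbT; apply: contra_neq p0 => -> //.
Qed.

Lemma law_sum_event {t} (B : pred (t.+1.-tuple T)) :
  measurable [set w | B (past t w)] /\
  fine (P [set w | B (past t w)]) = \sum_(x | B x) law x.
Proof. by apply: fine_probability_sum; exact: measurable_past. Qed.

Lemma law_sum1 t : \sum_(x : t.+1.-tuple T) law x = 1.
Proof.
have [_ <-] := law_sum_event (t := t) predT.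
by rewrite (_ : mkset _ = setT) ?probability_setT//; apply/seteqP; split.
Qed.

(** The tower property: the newest state is integrated first, against [Q]. It stands in for
    conditional expectation. *)
Lemma law_sumS t (F : t.+2.-tuple T -> R) : \sum_x law x * F x =
  \sum_x law x * \sum_s Q (thead x) s * F (cons_tuple s x).
Proof.
rewrite (reindex (fun p : T * t.+1.-tuple T => cons_tuple p.1 p.2)) /=.
  rewrite -(pair_bigA _ (fun s x => law (cons_tuple s x) * F (cons_tuple s x))).
  rewrite exchange_big; apply: eq_bigr => x _; rewrite mulr_sumr.
  by apply: eq_bigr => s _; rewrite law_cons mulrA.
exists (fun x => (thead x, [tuple of behead x])) => [[s x] _|x _] /=.
  by congr pair; apply: val_inj.
by case/tupleP: x => s x; apply: val_inj.
Qed.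

Lemma law_pair t s s' :
  measurable [set w | X t w = s /\ X t.+1 w = s'] /\
  fine (P [set w | X t w = s /\ X t.+1 w = s'])
  = fine (P [set w | X t w = s]) * Q s s'.
Proof.
have ht w : thead (past t w) = X t w by case: t => [|t].
have h1 : [set w | X t w = s] = [set w | (thead (past t w) == s)].
  by apply/seteqP; split => w /=; rewrite ht => /eqP.
(* The newest state comes first: the head is the state at time [t.+1], the head of the tail that at
   time [t]. *)
have h2 : [set w | X t w = s /\ X t.+1 w = s'] = [set w |
   (fun x : t.+2.-tuple T =>
     (thead x == s') && (thead [tuple of behead x] == s))
     (past t.+1 w)].
  apply/seteqP; split => w /=.
    move=> [<- <-]; rewrite theadE eqxx -ht; apply/eqP.
    by congr thead; apply: val_inj.
  rewrite theadE => /andP[/eqP <- /eqP <-]; split=> //; rewrite -ht.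
  by congr thead; apply: val_inj.
rewrite h1 h2.
have [m ->] := law_sum_event (fun x : t.+2.-tuple T =>
  (thead x == s') && (thead [tuple of behead x] == s)).
split=> //.
have [_ ->] := law_sum_event (fun x : t.+1.-tuple T => thead x == s).
rewrite big_mkcond [in RHS]big_mkcond mulr_suml.
transitivity (\sum_(x : t.+2.-tuple T) law x * ((thead x == s') &&
   (thead [tuple of behead x] == s) : bool)%:R :> R).
  by apply: eq_bigr => x _; case: ifP; rewrite ?mulr1 ?mulr0.
rewrite law_sumS; apply: eq_bigr => x _.
rewrite (bigD1 s')//= big1 ?addr0 => [|s'' /negPf ns]; last first.
  by rewrite theadE ns mulr0.
rewrite theadE eqxx /=.
have -> : thead [tuple of behead (cons_tuple s' x)] = thead x.
  by congr thead; apply: val_inj.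
by case: eqP => [->|]; rewrite /= ?mulr1 ?mulr0 ?mul0r.
Qed.

Lemma measurable_transition (B : rel T) t :
  measurable [set w | B (X t w) (X t.+1 w)].
Proof.
suff -> : [set w | B (X t w) (X t.+1 w)] =
    \bigcup_(p in [set p : T * T | B p.1 p.2])
      [set w | X t w = p.1 /\ X t.+1 w = p.2].
  apply: fin_bigcup_measurable => [|p _]; first exact: finite_finset.
  exact: (proj1 (law_pair t p.1 p.2)).
apply/seteqP; split => [w /= Bw|w [[p q] /= Bpq [-> ->]]//].
by exists (X t w, X t.+1 w).
Qed.

End ChainLaw.

(** * Martingale law of large numbers *)

Section Martingale.
Context {R : realType} {d : measure_display} {Omega : measurableType d}.
Variables (P : probability Omega R).
Context {T : finType}.
Variables (X : nat -> Omega -> T) (Q : T -> T -> R).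
Hypothesis chainX : markov_chain_with P X Q.
Hypothesis Qst : stochastic_matrix Q.
Variable g : T -> R.

(** The martingale as a function of the trajectory, newest state first, so that its moments are
    finite sums against [law]. *)
Fixpoint seq_mart (h : seq T) : R :=
  if h is s :: h' then
    if h' is s' :: _ then seq_mart h' + (g s - kernel_op Q g s') else 0
  else 0.

Definition mart (t : nat) (w : Omega) : R :=
  \sum_(0 <= m < t) (g (X m.+1 w) - kernel_op Q g (X m w)).

Lemma seq_mart_cons s t (x : t.+1.-tuple T) :
  seq_mart (s :: x) = seq_mart x + (g s - kernel_op Q g (thead x)).
Proof. by case/tupleP: x. Qed.

Lemma thead_past t w : thead (past X t w) = X t w.
Proof. by case: t. Qed.

Lemma seq_mart_past t w : seq_mart (past X t w) = mart t w.
Proof.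
elim: t => [|t IH]; first by rewrite /mart big_geq.
rewrite /mart big_nat_recr//= -/(mart t w) -IH -(thead_past t).
by rewrite -seq_mart_cons.
Qed.

Definition increment_bound : R :=
  \sum_s \sum_s' `|g s - kernel_op Q g s'|.

Lemma le_increment_bound s s' : `|g s - kernel_op Q g s'| <= increment_bound.
Proof.
rewrite /increment_bound (bigD1 s)//= (bigD1 s')//= -addrA lerDl.
by rewrite addr_ge0 ?sumr_ge0// => ? _; rewrite sumr_ge0.
Qed.

Lemma increment_bound_ge0 : 0 <= increment_bound.
Proof. by apply: sumr_ge0 => s _; apply: sumr_ge0. Qed.

(** Increments have mean zero given the past, so the cross term vanishes and each step adds at most
    [increment_bound ^+ 2]. *)
Lemma mart_second_moment t :
  \sum_(x : t.+1.-tuple T) law P X x * seq_mart x ^+ 2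
  <= t%:R * increment_bound ^+ 2.
Proof.
elim: t => [|t IH].
  rewrite mul0r big1// => x _; case/tupleP: x => s x.
  by rewrite tuple0 /= expr0n mulr0.
rewrite (law_sumS _ _ _ chainX).
rewrite -[X in _ <= X * _]natr1 mulrDl mul1r.
apply: le_trans (lerD IH (lexx _)).
(* The constant is spread over the trajectories by total mass one, so that the comparison is
   termwise. *)
rewrite -[X in _ <= _ + X]mul1r -(law_sum1 _ _ _ chainX t).
rewrite mulr_suml -big_split/=; apply: ler_sum => x _.
rewrite -mulrDr ler_wpM2l ?law_ge0//.
have q1 : \sum_s Q (thead x) s = 1 by exact: (proj2 Qst).
have dg : \sum_s Q (thead x) s * (g s - kernel_op Q g (thead x)) = 0.
  under eq_bigr do rewrite mulrBr.
  by rewrite sumrB -mulr_suml q1 mul1r subrr.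
have -> : \sum_s Q (thead x) s * seq_mart (cons_tuple s x) ^+ 2 =
  seq_mart x ^+ 2
  + \sum_s Q (thead x) s * (g s - kernel_op Q g (thead x)) ^+ 2.
  transitivity (\sum_s Q (thead x) s * seq_mart x ^+ 2
   + 2 * seq_mart x * \sum_s Q (thead x) s * (g s - kernel_op Q g (thead x))
   + \sum_s Q (thead x) s * (g s - kernel_op Q g (thead x)) ^+ 2).
    rewrite mulr_sumr -!big_split; apply: eq_bigr => s _.
    by rewrite seq_mart_cons/=; ring.
  by rewrite dg mulr0 addr0 -mulr_suml q1 mul1r.
rewrite lerD2l -[leRHS]mul1r -q1 mulr_suml; apply: ler_sum => s _.
rewrite ler_wpM2l ?(proj1 Qst)// -real_normK ?num_real//.
by rewrite lerXn2r ?nnegrE ?increment_bound_ge0// le_increment_bound.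
Qed.

Lemma mart_chebyshev t (c : R) : 0 < c ->
  measurable [set w | c < `|mart t w|] /\
  fine (P [set w | c < `|mart t w|]) <= t%:R * increment_bound ^+ 2 / c ^+ 2.
Proof.
move=> c0.
have -> : [set w | c < `|mart t w|]
   = [set w | (fun x : t.+1.-tuple T => c < `|seq_mart x|) (past X t w)].
  by apply/seteqP; split => w /=; rewrite seq_mart_past.
have [m ->] := law_sum_event _ _ _ chainX
  (fun x : t.+1.-tuple T => c < `|seq_mart x|).
split=> //; rewrite ler_pdivlMr ?exprn_gt0//.
apply: le_trans (mart_second_moment t).
rewrite big_mkcond mulr_suml; apply: ler_sum => x _.
case: ifPn => [cx|_]; last by rewrite mul0r mulr_ge0 ?law_ge0 ?sqr_ge0.
rewrite ler_wpM2l ?law_ge0// -[leRHS]real_normK ?num_real//.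
by rewrite lerXn2r ?nnegrE// ltW.
Qed.

Lemma sum_inv_sqr_le n :
  \sum_(0 <= k < n) (k.+1%:R ^+ 2)^-1 <= 2 :> R.
Proof.
(* This stronger bound is inductive, because 1/a^2 <= 2/a - 2/(a+1) for a >= 1. *)
apply: (@le_trans _ _ (2 - 2 * n.+1%:R^-1)); last by rewrite gerBl mulr_ge0.
elim: n => [|n IH]; first by rewrite big_geq// invr1 mulr1 subrr.
rewrite big_nat_recr//=; apply: le_trans (lerD IH (lexx _)) _.
rewrite -(natr1 n.+1); set a : R := n.+1%:R.
have a1 : 1 <= a by rewrite ler1n.
rewrite -subr_ge0; have -> : 2 - 2 * (a + 1)^-1 - (2 - 2 * a^-1 + (a ^+ 2)^-1)
    = (a - 1) / (a ^+ 2 * (a + 1)).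
  by field; apply/andP; split; rewrite gt_eqF//; lra.
by rewrite divr_ge0 ?subr_ge0// mulr_ge0 ?sqr_ge0//; lra.
Qed.

(** At time (k+1)^2 Chebyshev gives a bound of order (k+1)^-2, which is summable, so Borel-Cantelli
    applies. The tolerances 1/(j+1) are countably many, which lets the null sets be united. *)
Lemma mart_squares (j : nat) : {ae P, forall w, exists N : nat,
  forall k, (N <= k)%N ->
    `|mart (k.+1 ^ 2) w| <= (k.+1 ^ 2)%:R * j.+1%:R^-1}.
Proof.
pose c (k : nat) : R := (k.+1 ^ 2)%:R * j.+1%:R^-1.
have c0 k : 0 < c k by rewrite mulr_gt0 ?invr_gt0 ?ltr0n.
pose F k := [set w | c k < `|mart (k.+1 ^ 2) w|].
have mF k : measurable (F k) := proj1 (mart_chebyshev _ _ (c0 k)).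
exists (lim_sup_set F); split.
- rewrite /lim_sup_set; apply: bigcapT_measurable => n.
  by apply: bigcup_measurable => *; exact: mF.
- apply: lim_sup_set_cvg0 => //.
  (* The final factor 2 bounds the sum of inverse squares. *)
  pose C := increment_bound ^+ 2 * j.+1%:R ^+ 2 * 2.
  apply: (@le_lt_trans _ _ C%:E); last by rewrite ltry.
  apply: lime_le; first by apply: is_cvg_nneseries => *; exact: measure_ge0.
  near=> n.
  have PF k : (P (F k) <= (increment_bound ^+ 2 * j.+1%:R ^+ 2
     * (k.+1%:R ^+ 2)^-1)%:E)%E.
    rewrite -(@fineK _ (P (F k))) ?fin_num_measure// lee_fin.
    apply: le_trans (proj2 (mart_chebyshev _ _ (c0 k))) _.
    have : k.+1%:R != 0 :> R by rewrite pnatr_eq0.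
    have : j.+1%:R != 0 :> R by rewrite pnatr_eq0.
    rewrite /c natrX; set a : R := k.+1%:R; set b : R := j.+1%:R => b0 a0.
    clearbody a b; rewrite le_eqVlt; apply/orP; left; apply/eqP.
    by field; rewrite a0 b0.
  apply: le_trans (lee_sum _ (fun k _ => PF k)) _.
  rewrite sumEFin lee_fin -mulr_sumr ler_wpM2l ?sum_inv_sqr_le//.
  by rewrite mulr_ge0 ?sqr_ge0.
- move=> w /= nw n _; apply: contrapT => h; apply: nw; exists n => k nk.
  by rewrite leNgt; apply/negP => hk; apply: h; exists k.
Unshelve. all: by end_near. Qed.

End Martingale.

(** * Deterministic averages: from square times to all times *)

Section Averages.
Context {R : realType}.

Lemma normr_average_le (t : nat) (x e : R) : (0 < t)%N ->
  (`|t%:R^-1 * x| <= e) = (`|x| <= e * t%:R).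
Proof.
by move=> t0; rewrite normrM normfV normr_nat mulrC ler_pdivrMr// ltr0n.
Qed.

Lemma cvg_bounded_average (a : nat -> R) (C : R) :
  (forall t, `|a t| <= C) -> (fun t : nat => t%:R^-1 * a t) @ \oo --> 0.
Proof.
move=> aC; apply/cvgr0Pnorm_le => e e0.
have C0 : 0 <= C := le_trans (normr_ge0 _) (aC 0%N).
exists (Num.bound (C / e)).+1 => // t /= tN.
rewrite normr_average_le ?(le_trans (aC t))//; last by lia.
rewrite mulrC -ler_pdivrMr//; apply: ltW; apply: lt_trans (archi_boundP _) _.
  by rewrite divr_ge0// ltW.
by rewrite ltr_nat.
Qed.

Lemma square_gap (t : nat) : (0 < t)%N ->
  exists k, (k.+1 ^ 2 <= t)%N /\ (t < k.+2 ^ 2)%N.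
Proof.
case: t => // t _; elim: t => [|t [k [kt tk]]]; first by exists 0%N.
case: (ltnP t.+2 (k.+2 ^ 2)) => h; [exists k|exists k.+1]; split=> //.
  exact: leqW.
have -> : t.+2 = (k.+2 ^ 2)%N by apply/eqP; rewrite eqn_leq tk h.
by rewrite ltn_exp2r.
Qed.

(** Between (k+1)^2 and (k+2)^2 the sequence moves by at most 2K(k+1), which is negligible against
    [t]. *)
Lemma lipschitz_cvg_average (a : nat -> R) (K : R) :
  (forall t, `|a t.+1 - a t| <= K) ->
  (forall j : nat, exists N : nat, forall k, (N <= k)%N ->
     `|a (k.+1 ^ 2)%N| <= (k.+1 ^ 2)%:R * j.+1%:R^-1) ->
  (fun t : nat => t%:R^-1 * a t) @ \oo --> 0.
Proof.
move=> aK sq; apply/cvgr0Pnorm_le => e e0.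
have K0 : 0 <= K := le_trans (normr_ge0 _) (aK 0%N).
have lip i t : `|a (t + i)%N - a t| <= K *+ i.
  elim: i => [|i IH]; first by rewrite addn0 subrr normr0.
  rewrite addnS mulrS.
  have -> : a (t + i).+1 - a t
    = (a (t + i).+1 - a (t + i)%N) + (a (t + i)%N - a t).
    by ring.
  by apply: le_trans (ler_normD _ _) _; exact: lerD.
(* [j] makes the error at the squares at most half of [e * t], and [N'] does the same for the drift
   2K(k+1) since the last square. *)
pose j := Num.bound (2 / e); pose N' := Num.bound (4 * K / e).
have [N sqN] := sq j.
exists ((maxn N N').+1 ^ 2)%N => // t /= tN.
have t0 : (0 < t)%N by apply: leq_trans tN; rewrite expn_gt0.
have [k [kt tk]] := square_gap t t0.
have km : (maxn N N' <= k)%N.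
  by have := leq_ltn_trans tN tk; rewrite ltn_exp2r.
have /sqN ak : (N <= k)%N by apply: leq_trans km; exact: leq_maxl.
have kN' : (N' <= k)%N by apply: leq_trans km; exact: leq_maxr.
have at_ : `|a t| <= (k.+1 ^ 2)%:R * j.+1%:R^-1 + K *+ (2 * k.+1).
  have -> : a t = a (k.+1 ^ 2)%N + (a t - a (k.+1 ^ 2)%N) by ring.
  apply: le_trans (ler_normD _ _) (lerD ak _).
  rewrite -[X in a X - _](subnKC kt); apply: le_trans (lip _ _) _.
  by rewrite ler_wpMn2l//; move: tk; rewrite !expnS !expn0; lia.
rewrite normr_average_le ?(le_trans at_)//.
have j1 : j.+1%:R^-1 <= e / 2.
  rewrite -[leRHS]invrK lef_pV2 ?posrE ?invr_gt0 ?divr_gt0// invf_div.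
  apply/ltW/(lt_trans (archi_boundP _)); first by rewrite divr_ge0// ltW.
  by rewrite ltr_nat.
have Kk : K *+ (2 * k.+1) <= e / 2 * (k.+1 ^ 2)%:R.
  have : 4 * K / e <= k.+1%:R.
    apply/ltW/(lt_le_trans (archi_boundP _)).
      by rewrite divr_ge0 ?mulr_ge0// ltW.
    by rewrite ler_nat leqW.
  rewrite ler_pdivrMr// => h.
  rewrite -[K *+ _]mulr_natr natrX natrM; have : 0 <= k.+1%:R :> R by [].
  by move: h; set x : R := k.+1%:R; clearbody x; nra.
apply: (@le_trans _ _ (e * (k.+1 ^ 2)%:R)); last first.
  by rewrite ler_wpM2l ?ler_nat// ltW.
have xj : (k.+1 ^ 2)%:R / j.+1%:R <= e / 2 * (k.+1 ^ 2)%:R.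
  by rewrite mulrC ler_wpM2r.
by apply: le_trans (lerD xj Kk) _; rewrite -mulrDl -splitr.
Qed.

End Averages.

(** * Averages of [g - Qg] along the chain *)

Section CoboundaryAverages.
Context {R : realType} {d : measure_display} {Omega : measurableType d}.
Variables (P : probability Omega R).

(** Supplies one sample point at which several almost sure properties can be compared. *)
Lemma ae_positive_event (A : set Omega) (B : Omega -> Prop) :
  measurable A -> 0 < fine (P A) -> {ae P, forall w, B w} ->
  exists w, A w /\ B w.
Proof.
move=> mA A0 [N [mN N0 NB]]; apply: contrapT => nex.
suff AN : A `<=` N.
  have := fine_probability_le P A N mA mN AN.
  by rewrite N0 leNgt A0.
by move=> w Aw; apply: NB => /= Bw; apply: nex; exists w.
Qed.

Context {T : finType}.
Variables (X : nat -> Omega -> T) (Q : T -> T -> R).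
Hypothesis chainX : markov_chain_with P X Q.
Hypothesis Qst : stochastic_matrix Q.

(** The sum differs from the martingale by the telescoping term [g (X 0 w) - g (X t w)], which is
    bounded. *)
Lemma coboundary_average_cvg0 (g : T -> R) : {ae P, forall w,
  (fun t : nat => t%:R^-1 *
     \sum_(0 <= m < t) (g (X m w) - kernel_op Q g (X m w))) @ \oo --> 0}.
Proof.
have := ae_foralln (mart_squares P X Q chainX Qst g).
apply: filterS => w sq.
have Mcvg := lipschitz_cvg_average (fun t => mart X Q g t w)
  (increment_bound Q g) _ sq.
have bcvg : (fun t : nat => t%:R^-1 * (g (X 0 w) - g (X t w))) @ \oo --> 0.
  apply: (cvg_bounded_average _ (2 * \sum_s `|g s|)) => t.
  have gs s : `|g s| <= \sum_s `|g s|.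
    by rewrite [leRHS](bigD1 s)//= lerDl sumr_ge0.
  apply: le_trans (ler_normB _ _) _.
  by rewrite mulr_natl mulr2n lerD.
have lip t : `|mart X Q g t.+1 w - mart X Q g t w| <= increment_bound Q g.
  rewrite /mart big_nat_recr//= addrAC subrr add0r.
  exact: le_increment_bound.
suff -> : (fun t : nat => t%:R^-1 *
    \sum_(0 <= m < t) (g (X m w) - kernel_op Q g (X m w)))
  = (fun t : nat => t%:R^-1 * mart X Q g t w)
    + (fun t : nat => t%:R^-1 * (g (X 0 w) - g (X t w))).
  by rewrite -[X in _ --> X]addr0; exact: cvgD (Mcvg lip) bcvg.
apply: funext => t; rewrite -[RHS]mulrDr; congr (_ * _).
rewrite -opprB -(telescope_sumr (fun m => g (X m w)) (leq0n t)) /mart -sumrB.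
by apply: eq_bigr => m _; ring.
Qed.

(** A forbidden transition at a given time is a null event, and there are countably many of them. *)
Lemma ae_transition_gt0 : {ae P, forall w m, 0 < Q (X m w) (X m.+1 w)}.
Proof.
apply: ae_foralln => m.
pose B (s s' : T) := [set w | X m w = s /\ X m.+1 w = s'].
suff : {ae P, forall w, forall s s', 0 < Q s s' \/ ~ B s s' w}.
  apply: filterS => w /(_ (X m w) (X m.+1 w))[//|nB].
  by exfalso; apply: nB.
apply: filter_forall => s; apply: filter_forall => s'.
have [Qss'|Qss'] := ltP 0 (Q s s'); first by apply: nearW => w; left.
have [mB PB] := law_pair P X Q chainX m s s'.
exists (B s s'); split => //.
- apply/eqP; rewrite -fine_eq0 ?fin_num_measure//; apply/eqP.
  have -> : 0 = fine (P [set w | X m w = s]) * Q s s'; last exact: PB.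
  have -> : Q s s' = 0 by apply/eqP; rewrite eq_le Qss' (proj1 Qst).
  by rewrite mulr0.
- by move=> w /= nh; apply: contrapT => nB; apply: nh; right.
Qed.

End CoboundaryAverages.

(** * Chains with prescribed frequencies *)

Section Visits.
Context {R : realType} {d : measure_display} {Omega : measurableType d}.
Variables (P : probability Omega R).
Context {S : finType}.
Variables (X : nat -> Omega -> S) (Q : S -> S -> R) (mu : S -> R).
Hypothesis chainX : markov_chain_with P X Q.
Hypothesis Qst : stochastic_matrix Q.
Hypothesis freq : frequencies_converge P X mu.

(** The number of visits never exceeds [M], so its average tends to zero. *)
Lemma finite_visits_frequency (x : nat -> S) (s : S) (M : nat) (l : R) :
  (forall m, (M <= m)%N -> x m != s) ->
  (fun t : nat => t%:R^-1 * \sum_(0 <= m < t) (x m == s)%:R : R) @ \oo --> l ->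
  l = 0.
Proof.
move=> xM xl; apply: (cvg_unique _ xl) => //.
apply: (cvg_bounded_average _ M%:R) => t.
rewrite ger0_norm ?sumr_ge0//.
have le1 n : \sum_(0 <= m < n) (x m == s)%:R <= n%:R :> R.
  rewrite -[leRHS]mulr1 -[X in X%:R * 1]subn0 mulr_natl -sumr_const_nat.
  by apply: ler_sum => m _; case: eqP.
have [tM|/ltnW Mt] := leqP t M; first by rewrite (le_trans (le1 t))// ler_nat.
have no_visit : \sum_(M <= m < t) (x m == s)%:R = 0 :> R.
  by rewrite big_nat big1// => m /andP[/xM/negPf ->].
by rewrite (big_cat_nat (n := M))//= no_visit addr0.
Qed.

Lemma frequency_gt0_visited s : 0 < mu s ->
  exists t, 0 < fine (P [set w | X t w = s]).
Proof.
move=> mus; apply: contrapT => nv.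
have nvis t : fine (P [set w | X t w = s]) = 0.
  apply/eqP; rewrite eq_le fine_probability_ge0 andbT leNgt; apply/negP => h.
  by apply: nv; exists t.
have ns : {ae P, forall w m, X m w != s}.
  apply: ae_foralln => m; exists [set w | X m w = s]; split.
  - exact: (proj1 chainX).
  - apply/eqP; rewrite -fine_eq0 ?fin_num_measure ?nvis//.
    exact: (proj1 chainX).
  - by move=> w /= /negP; rewrite negbK => /eqP.
have P1 : 0 < fine (P setT) by rewrite probability_setT.
have [w [_ [fw nw]]] := ae_positive_event P setT _ measurableT P1
  (filterI freq ns).
by rewrite (finite_visits_frequency (X^~ w) s 0 _ _ (fw s)) ?ltxx// in mus.
Qed.

Lemma frequency_invariant s' : \sum_s mu s * Q s s' = mu s'.
Proof.
have P1 : 0 < fine (P setT) by rewrite probability_setT.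
pose g s : R := (s == s')%:R.
have gE (f : S -> R) : \sum_s f s * g s = f s'.
  rewrite (bigD1 s')//= /g eqxx mulr1 big1 ?addr0// => s /negPf ->.
  by rewrite mulr0.
have [w [_ [fw cw]]] := ae_positive_event P setT _ measurableT P1
  (filterI freq (coboundary_average_cvg0 P X Q chainX Qst g)).
pose h s := g s - kernel_op Q g s.
(* The average of [h] along the path is a linear combination of the empirical frequencies; its two
   limits at [w], one through [freq] and one through the coboundary, must agree. *)
have hcvg : (fun t : nat => \sum_s h s * (t%:R^-1 *
    \sum_(0 <= m < t) (X m w == s)%:R)) @ \oo --> \sum_s h s * mu s.
  apply: cvg_big => //= [|s _]; first exact: add_continuous.
  by apply: cvgMr; exact: fw.
have hE : (fun t : nat => \sum_s h s * (t%:R^-1 *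
    \sum_(0 <= m < t) (X m w == s)%:R))
  = (fun t : nat => t%:R^-1 * \sum_(0 <= m < t) h (X m w)).
  apply: funext => t; under eq_bigr do rewrite mulrCA mulr_sumr.
  rewrite -mulr_sumr exchange_big/=; congr (_ * _); apply: eq_bigr => m _.
  rewrite (bigD1 (X m w))//= eqxx mulr1 big1 ?addr0// => s /negPf.
  by rewrite eq_sym => ->; rewrite mulr0.
rewrite hE in hcvg.
have h0 : \sum_s h s * mu s = 0.
  exact: (cvg_unique (@norm_hausdorff _ _) hcvg cw).
have : \sum_s mu s * g s - \sum_s mu s * kernel_op Q g s = 0.
  by rewrite -sumrB -[RHS]h0; apply: eq_bigr => s _; rewrite /h; ring.
rewrite gE => /eqP; rewrite subr_eq0 => /eqP ->.
by apply: eq_bigr => s _; rewrite /kernel_op gE.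
Qed.

Variable E : rel S.
Hypothesis consX : consistent P X E.

(** The state [s] is visited at some time with positive probability, so the jump to [s'] is then a
    positive event and meets the almost sure event of consistency. *)
Lemma frequency_transition_adjacent s s' :
  0 < mu s -> 0 < Q s s' -> adjacent_in E s s'.
Proof.
move=> /frequency_gt0_visited [t Pt] Qss'.
have [mB PB] := law_pair P X Q chainX t s s'.
have mA := measurable_transition P X Q chainX (adjacent_in E) t.
have aeA : {ae P, forall w, adjacent_in E (X t w) (X t.+1 w)}.
  exists (~` [set w | adjacent_in E (X t w) (X t.+1 w)]); split => //.
  - exact: measurableC.
  - by rewrite probability_setC// consX subee.
have pos : 0 < fine (P [set w | X t w = s /\ X t.+1 w = s']).
  by rewrite PB mulr_gt0.
by have [w [[<- <-]]] := ae_positive_event P _ _ mB pos aeA.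
Qed.

Hypothesis mu_ge0 : forall s, 0 <= mu s.

(** By invariance the mass of [s'] is at least [mu s * Q s s']. *)
Lemma frequency_support_closed s s' : 0 < mu s -> 0 < Q s s' -> 0 < mu s'.
Proof.
move=> mus Qss'; rewrite -frequency_invariant (bigD1 s)//=.
rewrite ltr_pwDl ?mulr_gt0// sumr_ge0// => x _.
by rewrite mulr_ge0// (proj1 Qst).
Qed.

Lemma frequency_support_connected : connected_graph (induced_graph E (supp mu)).
Proof.
move=> s0 t0; apply: contrapT => /negP nconn.
have mu0 (s : {s | s \in supp mu}) : 0 < mu (val s).
  by have := valP s; rewrite inE.
have [M PM] := frequency_gt0_visited _ (mu0 s0).
have mM : measurable [set w | X M w = val s0] by exact: (proj1 chainX).
have [w [wM [fw Qw]]] := ae_positive_event P _ _ mM PM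
  (filterI freq (ae_transition_gt0 P X Q chainX Qst)).
(* From time [M] on, this path stays in the support and in the component of [s0]; a jump may also
   stay in place. *)
have stay k : exists2 s, val s = X (M + k)%N w &
    connect (induced_graph E (supp mu)) s0 s.
  elim: k => [|k [s sE s0s]]; first by exists s0; rewrite ?addn0.
  have Qs : 0 < Q (val s) (X (M + k.+1)%N w) by rewrite sE addnS.
  have mus' : X (M + k.+1)%N w \in supp mu.
    by rewrite inE (frequency_support_closed (val s)).
  pose s' : {s | s \in supp mu} := exist (fun x => x \in supp mu) _ mus'.
  exists s' => //.
  apply: connect_trans s0s _.
  have /orP[Ess'|/eqP ss'] := frequency_transition_adjacent _ _ (mu0 s) Qs.
    exact: connect1.
  by rewrite (_ : s = s') ?connect0//; apply: val_inj.
have := mu0 t0.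
(* Outside that component, [t0] is not visited after time [M], so its frequency would be zero. *)
rewrite (finite_visits_frequency (X^~ w) _ M _ _ (fw (val t0))) ?ltxx// => m Mm.
have [s sE s0s] := stay (m - M)%N; rewrite subnKC// in sE.
apply: contra nconn => /eqP mt; rewrite (_ : t0 = s)//.
by apply: val_inj; rewrite sE mt.
Qed.

End Visits.

(** * The two halves of the theorem, (b) before (a) in the proof *)

Theorem theorem3 (R : realType) (S : finType) (E : rel S) (mu : S -> R)
  (E_sym : symmetric E) (E_irr : irreflexive E)
  (mu_distr : distribution_on mu) :
  (connected_graph (induced_graph E (supp mu)) ->
   forall (n : nat) (lab : 'I_n.+1 -> {s : S | s \in supp mu})
     (Q : {s : S | s \in supp mu} -> {s : S | s \in supp mu} -> R)
     (d : measure_display) (Omega : measurableType d)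
     (P : probability Omega R) (X : nat -> Omega -> {s : S | s \in supp mu}),
     decreasing_labelling lab ->
     (forall l m : 'I_n.+1, Q (lab l) (lab m) = P_matrix E lab l m) ->
     markov_chain_with P X Q ->
     frequencies_converge P (fun t w => val (X t w)) mu /\
     consistent P (fun t w => val (X t w)) E)
  /\
  (~ connected_graph (induced_graph E (supp mu)) ->
   forall (d : measure_display) (Omega : measurableType d)
     (P : probability Omega R) (X : nat -> Omega -> S),
     homogeneous_markov_chain P X ->
     consistent P X E ->
     ~ frequencies_converge P X mu).
Proof.
have [mu_ge0 mu_sum1] := mu_distr.
split; last first.
  move=> nconn d Omega P X [Q [Qst chainX]] consX freq; apply: nconn.
  exact: (frequency_support_connected P X Q mu chainX Qst freq E consX mu_ge0).
move=> conn n lab Q d Omega P X [lab_bij _] QE chainX.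
pose T := {s : S | s \in supp mu}.
have [inv labK invK] := lab_bij.
have QinvE s s' : Q s s' = P_matrix E lab (inv s) (inv s').
  by rewrite -QE !invK.
have Qst : stochastic_matrix Q.
  split=> [s s'|s]; first by rewrite QinvE; exact: P_matrix_ge0.
  rewrite (reindex lab); last exact: onW_bij.
  rewrite -(P_matrix_row_sum E mu n lab (inv s)).
  by apply: eq_bigr => l _; rewrite QinvE labK.
pose pi (s : T) := mu (val s).
have pi_gt0 s : 0 < pi s by have := valP s; rewrite inE.
have mu_out s : s \notin supp mu -> mu s = 0.
  by rewrite inE => h; apply/eqP; rewrite eq_le mu_ge0 andbT leNgt.
have sum_supp (f : S -> R) : \sum_(s : T) pi s * f (val s) = \sum_s mu s * f s.
  rewrite -(big_sub (supp mu) (fun s => mu s * f s)) big_mkcond.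
  by apply: eq_bigr => s _; case: ifPn => // /mu_out ->; rewrite mul0r.
have pi_sum1 : \sum_s pi s = 1.
  rewrite -mu_sum1; have := sum_supp (fun=> 1).
  by rewrite -!mulr_suml !mulr1.
have Qrev s s' : pi s * Q s s' = pi s' * Q s' s.
  have := P_matrix_reversible E mu n lab E_sym (inv s) (inv s').
  by rewrite !invK -!QinvE.
have Qpos s s' : induced_graph E (supp mu) s s' -> 0 < Q s s'.
  move=> ss'; rewrite QinvE; apply: P_matrix_edge_gt0 => //.
  by rewrite /lab_edge !invK.
split; last first.
  move=> t.
  (* Almost surely only transitions with a positive entry are taken, and those join adjacent
     vertices. *)
  have aeA : {ae P, forall w, adjacent_in E (val (X t w)) (val (X t.+1 w))}.
    apply: filterS (ae_transition_gt0 P X Q chainX Qst) => w /(_ t) Qt.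
    have := P_matrix_adjacent E mu n lab (inv (X t w)) (inv (X t.+1 w)).
    by rewrite -QinvE !invK gt_eqF//; apply.
  have mA := measurable_transition P X Q chainX
    (fun s s' => adjacent_in E (val s) (val s')) t.
  rewrite -[X in P X]setCK probability_setC; last exact: measurableC.
  by rewrite (measure_negligible _ aeA) ?sube0//; exact: measurableC.
apply: filter_forall => s.
(* The solvability condition of the Poisson equation. For [s] outside the support the function is
   zero. *)
have hs0 : \sum_s' pi s' * ((val s' == s)%:R - mu s) = 0.
  rewrite (sum_supp (fun s' => (s' == s)%:R - mu s)).
  under eq_bigr do rewrite mulrBr.
  rewrite sumrB -mulr_suml mu_sum1 mul1r (bigD1 s)//= eqxx mulr1.
  by rewrite big1 ?addr0 ?subrr// => s' /negPf ->; rewrite mulr0.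
have [g hg] := poisson_equation Q pi pi_gt0 pi_sum1 Qst Qrev
  (induced_graph E (supp mu)) conn Qpos _ hs0.
apply: filterS (coboundary_average_cvg0 P X Q chainX Qst g) => w cw.
(* The factor [(0 < t)%:R] accounts for time 0, where the average is 0 by the convention on [0^-1];
   the two sequences then agree at every time. *)
have : (fun t : nat =>
   t%:R^-1 * \sum_(0 <= m < t) (g (X m w) - kernel_op Q g (X m w))
   + (0 < t)%:R * mu s) @ \oo --> mu s.
  rewrite -[X in _ --> X]add0r; apply: cvgD => //.
  by apply: cvg_near_cst; exists 1%N => // t /= t0; rewrite t0 mul1r.
rewrite (eq_cvg _ _ (g := fun t : nat =>
  t%:R^-1 * \sum_(0 <= m < t) (val (X m w) == s)%:R : R)) // => t.
under eq_bigr do rewrite -hg.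
rewrite sumrB sumr_const_nat subn0 mulrBr -[mu s *+ _]mulr_natl mulrA.
case: t => [|t]; first by rewrite big_geq// mul0r invr0 !mul0r subrr addr0.
by rewrite mulVf ?pnatr_eq0// subrK.
Qed.
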